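(* Let $\tau$ be an infinite cardinal number, $X$ be a $\tau$-metacompact (Hausdorff) space and $E$ be a Fréchet space with $d(E)\leq\tau$. Then the following are equivalent: (a) Each convex-valued open relation $\Theta:X\leadsto E$ has a continuous selection. (b) Each closed-convex-valued l.s.c. relation $\Phi:X\leadsto E$ has a continuous selection.
   Context: All topological spaces are assumed Hausdorff and all vector spaces are real. $d(E)$ denotes the density of $E$ (least cardinality of a dense subset). A space $X$ is $\tau$-metacompact if every open cover of $X$ of cardinality $\leq\tau$ has a point-finite open refinement (covering $X$). A metric $d$ on a vector space $E$ is invariant if $d(u+w,v+w)=d(u,v)$ for all $u,v,w\in E$. A topological vector space is Fréchet if it is locally convex and its topology is generated by a complete invariant metric. For a relation $\Phi\subset X\times Y$, $\Phi(x)=\{y\in Y:\langle x,y\rangle\in\Phi\}$ and $\Phi^{-1}[U]=\{x\in X:\Phi(x)\cap U\neq\varnothing\}$ for $U\subset Y$; writing $\Phi:X\leadsto Y$ means that $\Phi(x)\neq\varnothing$ for every $x\in X$. $\Phi$ is open if it is an open subset of $X\times Y$; it is l.s.c. (lower semi-continuous) if $\Phi^{-1}[U]$ is open in $X$ for every open $U\subset Y$. Convex-valued (closed-convex-valued) means that each $\Phi(x)$ is convex (closed and convex). A selection for $\Phi:X\leadsto Y$ is a map $f:X\to Y$ with $f(x)\in\Phi(x)$ for every $x\in X$. *)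

(* Defs.v *)
From HB Require Import structures.
From mathcomp Require Import all_boot all_order all_algebra.
From mathcomp Require Import all_classical all_reals all_analysis.

Set Implicit Arguments.
Unset Strict Implicit.
Unset Printing Implicit Defensive.

Import Order.TTheory GRing.Theory Num.Theory.
Import numFieldNormedType.Exports.

Local Open Scope classical_set_scope.
Local Open Scope card_scope.
Local Open Scope ring_scope.

Section metrics.
Variables (R : realType) (T : Type) (d : T -> T -> R).

Definition is_metric := [/\ forall x y, d x y = 0 <-> x = y,
  forall x y, d x y = d y x & forall x y z, d x z <= d x y + d y z].

Definition metric_complete := forall u : nat -> T,
  (forall e, 0 < e -> \forall m & n \near \oo, d (u m) (u n) < e) ->
  exists l, forall e, 0 < e -> \forall n \near \oo, d l (u n) < e.

End metrics.

Definition generates_topology (R : realType) (T : topologicalType)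
    (d : T -> T -> R) :=
  forall x : T, nbhs x = nbhs_ball_ (fun y e => [set z | d y z < e]) x.

Definition invariant_metric (R : realType) (E : zmodType) (d : E -> E -> R) :=
  forall u v w, d (u + w) (v + w) = d u v.

(* [tvsType] is the type of locally convex topological vector spaces. The
   uniform structure it carries only has to induce the topology and is unrelated
   to the metric, so completeness is stated for the metric itself. *)
Definition frechet (R : realType) (E : tvsType R) :=
  exists d : E -> E -> R, [/\ is_metric d, generates_topology d,
    invariant_metric d & metric_complete d].

(* A cardinal is represented by a type [tau] having that many elements. *)

Definition point_finite (X : Type) (V : set (set X)) :=
  forall x, finite_set [set A | V A /\ A x].

Definition open_cover (X : topologicalType) (U : set (set X)) :=
  U `<=` open /\ \bigcup_(A in U) A = [set: X].

Definition refines (X : Type) (V U : set (set X)) :=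
  forall B, V B -> exists2 A, U A & B `<=` A.

Definition card_metacompact (tau : Type) (X : topologicalType) :=
  forall U : set (set X), open_cover U -> U #<= [set: tau] ->
  exists V : set (set X), [/\ open_cover V, refines V U & point_finite V].

(* [D] is a dense set of least cardinality, i.e., it realizes the density. *)
Definition realizes_density (E : topologicalType) (D : set E) :=
  dense D /\ forall D' : set E, dense D' -> D #<= D'.

Definition density_le (E : topologicalType) (tau : Type) :=
  exists2 D : set E, realizes_density D & D #<= [set: tau].

Section relations.
Variables X Y : Type.
Implicit Type Phi : set (X * Y).

(* The value of [Phi] at [x] is [xsection Phi x]. *)

Definition nonempty_valued Phi := forall x, xsection Phi x !=set0.

Definition rel_preimage Phi (U : set Y) : set X :=
  [set x | xsection Phi x `&` U !=set0].

Definition selection Phi (f : X -> Y) := forall x, xsection Phi x (f x).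

End relations.

Definition lower_semicontinuous_rel (X Y : topologicalType)
    (Phi : set (X * Y)) :=
  forall U : set Y, open U -> open (rel_preimage Phi U).

Definition convex_valued (R : realType) (X : Type) (E : lmodType R)
    (Phi : set (X * E)) :=
  forall x, convex_set (xsection Phi x).

Definition closed_valued (X : Type) (Y : topologicalType)
    (Phi : set (X * Y)) :=
  forall x, closed (xsection Phi x).

(* Main.v *)
Require Import Defs.
From HB Require Import structures.
From mathcomp Require Import all_boot all_order all_algebra.
From mathcomp Require Import all_classical all_reals all_analysis.
From mathcomp Require Import lra.

Set Implicit Arguments.
Unset Strict Implicit.
Unset Printing Implicit Defensive.

Import Order.TTheory GRing.Theory Num.Theory.
Import numFieldNormedType.Exports.

Local Open Scope classical_set_scope.
Local Open Scope card_scope.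
Local Open Scope ring_scope.

(** From closed-convex-valued to open relations, the idea is to carve out of an
    open convex-valued [Theta] an l.s.c. relation with closed convex values.
    The open sets [{x | Theta(x) contains y}], for [y] in a dense set of
    cardinality at most [tau], cover [X].  Pick a point [c(B)] for each member
    [B] of a point-finite open refinement, so that [c(B)] lies in [Theta(x)]
    for all [x] in [B], and let [Phi(x)] be the closed convex hull of the
    finitely many [c(B)] with [x] in [B].  The hull stays inside [Theta(x)]
    because a finite subset of an open convex set can be translated by a whole
    neighbourhood of the origin ([closed_convex_hull_sub]); it is l.s.c.
    because the members of the refinement that contain [x] also contain all
    points near [x], so the hull locally only grows
    ([lsc_finite_hull_selector]).

    From open to closed-convex-valued relations, the proof is Michael's
    successive approximation.  If a continuous [f] is [V]-close to an l.s.c.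
    [Phi], meaning that [f(x) - z] lies in [V] for some [z] in [Phi(x)], then
    the points which are [W]-close to those [z] form an open convex-valued
    relation ([open_approximation_rel]).  A continuous selection of it is
    [W]-close to [Phi] and, through [z], also close to [f].  Iterating with
    convex neighbourhoods of the origin of diameter about [2^-n] gives a
    uniformly Cauchy sequence of continuous maps; its limit is continuous, and
    lies in [Phi(x)] because [Phi(x)] is closed. *)

(** * Convex combinations *)

Section convex_combinations.
Context {R : realType} {E : lmodType R}.
Local Notation avg t x y := (@conv R (convex_lmodType E) t x y).

Lemma convD_lmod (x y u v : E) (t : {i01 R}) :
  (avg t x y : E) + avg t u v = avg t (x + u) (y + v).
Proof. by rewrite /conv/= !scalerDr addrACA. Qed.

Lemma convB_lmod (x y u v : E) (t : {i01 R}) :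
  (avg t x y : E) - avg t u v = avg t (x - u) (y - v).
Proof. by rewrite /conv/= !scalerBr opprD addrACA. Qed.

Lemma convex_setP (A : set E) : convex_set A <->
  forall x y (t : {i01 R}), A x -> A y -> A (avg t x y).
Proof.
split=> [cA x y t /mem_set Ax /mem_set Ay|cA x y t].
  exact/set_mem/(cA x y t Ax Ay).
by rewrite !inE; exact: cA.
Qed.

End convex_combinations.

(** * Closed convex hulls of finite sets *)

Lemma filter_finite_bigI (T : Type) (I : choiceType) (D : set I)
    (f : I -> set T) (F : set_system T) : Filter F -> finite_set D ->
  (forall i, D i -> F (f i)) -> \forall x \near F, forall i, D i -> f i x.
Proof.
move=> FF /finite_fsetP[K ->] Df.
exact: (@filter_bigI T I K f F).
Qed.

Definition closed_convex_hull {R : realType} {E : tvsType R} (A : set E) :=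
  smallest (fun C : set E => closed C /\ convex_set C) A.

Section closed_convex_hulls.
Context {R : realType} {E : tvsType R}.
Implicit Types A U W : set E.

Lemma closed_closed_convex_hull A : closed (closed_convex_hull A).
Proof. by apply: closed_bigI => C [[]]. Qed.

Lemma convex_closed_convex_hull A : convex_set (closed_convex_hull A).
Proof.
apply/convex_setP => x y t hx hy C C_A; have [[_ /convex_setP cC] _] := C_A.
by apply: cC; [exact: hx|exact: hy].
Qed.

Lemma nbhs_addr z w W : nbhs (z + w) W -> \forall y \near z, W (y + w).
Proof.
move=> /(@add_continuous E (z, w))[[P Q]/= [zP wQ] PQ].
apply: filterS zP => y Py; apply: (PQ (y, w)); split => //=.
exact: nbhs_singleton.
Qed.

(** The points [z] with [z + W] inside [U] form a convex set, and also a closed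
    one since [W] is open: if [y] is close to [z] then [z + w = y + w'] with
    [w'] in [W] close to [w].  For [W] small enough it contains the finite set
    [A], hence the hull of [A]. *)
Lemma closed_convex_hull_sub A U : finite_set A -> open U -> convex_set U ->
  A `<=` U -> closed_convex_hull A `<=` U.
Proof.
move=> finA oU /convex_setP cU AU.
have [W [oW W0 AW]] : exists W : set E,
    [/\ open W, W 0 & forall a w, A a -> W w -> U (a + w)].
  have : nbhs (0 : E) [set w | forall a, A a -> U (a + w)].
    apply: (filter_finite_bigI (f := fun a => [set w | U (a + w)]) _ finA).
    move=> a /AU Ua; have /nbhs_addr : nbhs (0 + a) U.
      by rewrite add0r; exact: open_nbhs_nbhs.
    by apply: filterS => w; rewrite addrC.
  rewrite nbhsE => -[W [oW W0] WU]; exists W; split=> // a w Aa Ww.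
  exact: WU.
suff : closed_convex_hull A `<=` [set z | forall w, W w -> U (z + w)].
  by move=> h z /h /(_ 0 W0); rewrite addr0.
apply: smallest_sub; last by move=> a Aa w; exact: AW.
split; last first.
  apply/convex_setP => x y t /= hx hy w Ww.
  rewrite -[w](convmm t (w : convex_lmodType E)) convD_lmod.
  by apply: cU; [exact: hx|exact: hy].
move=> z clz w Ww.
have : \forall y \near z, W (z + w - y).
  have /(@sub_continuous E (z + w, z)) : nbhs ((z + w, z).1 - (z + w, z).2) W.
    by rewrite /= addrAC subrr add0r; exact: open_nbhs_nbhs.
  move=> [[P Q]/= [Pzw Qz] PQ]; apply: filterS Qz => y Qy.
  by apply: (PQ (z + w, y)); split => //=; exact: nbhs_singleton.
by move=> /clz[y [/= hy /hy]]; rewrite addrC subrK.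
Qed.

End closed_convex_hulls.

(** * Closed-convex-valued selectors of open relations *)

(** Finitely many open members of [V] contain [x], so they all contain every
    point [y] close to [x]; the hull at [y] then includes the hull at [x]. *)
Lemma lsc_finite_hull_selector (R : realType) (X : topologicalType)
    (E : tvsType R) (V : set (set X)) (c : set X -> E) :
  V `<=` open -> point_finite V ->
  lower_semicontinuous_rel [set p : X * E |
    closed_convex_hull (c @` [set B | V B /\ B p.1]) p.2].
Proof.
move=> oV pfV U oU; rewrite openE => x [z [/xsectionP/= hz Uz]].
have : \forall y \near x, forall B, V B /\ B x -> B y.
  apply: (filter_finite_bigI (f := id) _ (pfV x)) => B [VB Bx].
  by apply: open_nbhs_nbhs; split=> //; exact: oV.
apply: filterS => y Fy; exists z; split=> //; apply/xsectionP => /=.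
move: z hz {Uz}; apply: sub_smallest2r.
  by split; [exact: closed_closed_convex_hull|exact: convex_closed_convex_hull].
move=> _ [B VBx <-]; exists B => //; split; first by case: VBx.
exact: Fy.
Qed.

Lemma open_xsection_slice (X Y : topologicalType) (Theta : set (X * Y)) y :
  open Theta -> open [set x | xsection Theta x y].
Proof.
rewrite !openE => oT x /= /xsectionP /oT[[P Q]/= [Px Qy] PQ].
apply: filterS Px => x' Px'; apply/xsectionP/(PQ (x', y)).
by split=> //=; exact: nbhs_singleton.
Qed.

Lemma open_xsection (X Y : topologicalType) (Theta : set (X * Y)) x :
  open Theta -> open (xsection Theta x).
Proof.
rewrite !openE => oT y /xsectionP /oT[[P Q]/= [Px Qy] PQ].
apply: filterS Qy => y' Qy'; apply/xsectionP/(PQ (x, y')).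
by split=> //=; exact: nbhs_singleton.
Qed.

Lemma lsc_selector_of_open_rel (R : realType) (tau : Type)
    (X : topologicalType) (E : tvsType R) (Theta : set (X * E)) :
  card_metacompact tau X -> density_le E tau ->
  nonempty_valued Theta -> convex_valued Theta -> open Theta ->
  exists Phi : set (X * E), [/\ nonempty_valued Phi, closed_valued Phi,
    convex_valued Phi, lower_semicontinuous_rel Phi & Phi `<=` Theta].
Proof.
move=> mcX [D [dD _] Dtau] neT cvT oT.
pose slices := (fun y => [set x | xsection Theta x y]) @` D.
have slices_cover : open_cover slices.
  split; first by move=> _ [y _ <-]; exact: open_xsection_slice.
  rewrite -subTset => x _.
  have [y [Txy Dy]] := dD _ (neT x) (open_xsection x oT).
  by exists [set x | xsection Theta x y] => //; exists y.
have [] := mcX slices slices_cover.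
  exact: card_le_trans (card_image_le _ _) Dtau.
move=> V [[oV covV] refV pfV].
have [c cP] : {c : set X -> E &
    forall B, V B -> B `<=` [set x | xsection Theta x (c B)]}.
  apply: (@choice _ _ (fun B y => V B -> B `<=` [set x | xsection Theta x y])).
  move=> B; have [VB|nVB] := pselect (V B); last by exists 0.
  by have [_ [y _ <-] By] := refV B VB; exists y.
pose Phi : set (X * E) :=
  [set p | closed_convex_hull (c @` [set B | V B /\ B p.1]) p.2].
have PhiE x : xsection Phi x = closed_convex_hull (c @` [set B | V B /\ B x]).
  by apply/seteqP; split=> z; [move/xsectionP|move=> ?; exact/xsectionP].
exists Phi; split.
- move=> x; have [B VB Bx] : (\bigcup_(A in V) A) x by rewrite covV.
  exists (c B); rewrite PhiE.
  by apply: sub_smallest (@subset_refl _ _) _ _; exists B.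
- by move=> x; rewrite PhiE; exact: closed_closed_convex_hull.
- by move=> x; rewrite PhiE; exact: convex_closed_convex_hull.
- exact: lsc_finite_hull_selector.
- move=> [x z] /= hz; apply/xsectionP; apply: closed_convex_hull_sub hz.
  + exact/finite_image/pfV.
  + exact: open_xsection.
  + exact: cvT.
  + by move=> _ [B [VB Bx] <-]; exact: cP.
Qed.

(** * Invariant metrics *)

Section metrics.
Context {R : realType}.

Lemma exists_halfX_lt (e : R) : 0 < e -> exists n, 2^-1 ^+ n < e.
Proof.
move=> e0; have [n _ /(_ n (leqnn n))] :=
  near_infty_natSinv_expn_lt (PosNum e0).
by rewrite /= div1r -exprVn; exists n.
Qed.

Lemma dist_halfX_sum (T : Type) (d : T -> T -> R) (u : nat -> T) :
  is_metric d -> (forall n, d (u n) (u n.+1) <= 2^-1 ^+ n) ->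
  forall n k, d (u n) (u (n + k)%N) <= 2 * 2^-1 ^+ n - 2 * 2^-1 ^+ (n + k)%N.
Proof.
move=> [d0 _ dD] hu n; elim=> [|k IH].
  by rewrite addn0 (d0 _ _).2// subrr.
rewrite addnS; apply: le_trans (dD _ (u (n + k)%N) _) _.
have := hu (n + k)%N; rewrite exprS; lra.
Qed.

Lemma halfX_cauchy_limit (T : Type) (d : T -> T -> R) (u : nat -> T) :
  is_metric d -> metric_complete d ->
  (forall n, d (u n) (u n.+1) <= 2^-1 ^+ n) ->
  exists l, forall n, d l (u n) <= 2 * 2^-1 ^+ n.
Proof.
move=> md cd hu; have [d0 dC dD] := md.
have dle n m : (n <= m)%N -> d (u n) (u m) <= 2 * 2^-1 ^+ n.
  move=> /subnKC <-; apply: le_trans (dist_halfX_sum md hu _ _) _.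
  by rewrite gerBl mulr_ge0// exprn_ge0.
have [e e0|l lP] := cd u.
  have [N hN] : exists n, (2^-1 : R) ^+ n < e / 4.
    by apply: exists_halfX_lt; rewrite divr_gt0.
  exists ([set n | (N <= n)%N], [set n | (N <= n)%N]).
    by split; exists N.
  move=> [m n] [/= Nm Nn]; apply: le_lt_trans (dD _ (u N) _) _.
  have := dle N m Nm; have := dle N n Nn; rewrite (dC (u N) (u m)); lra.
exists l => n; apply/ler_addgt0Pr => e e0.
have [N _ hN] := lP e e0.
have := hN (maxn N n) (leq_maxl _ _); rewrite /= => h.
have := dle n (maxn N n) (leq_maxr _ _).
have := dD l (u (maxn N n)) (u n); rewrite (dC (u (maxn N n))); lra.
Qed.

Context {E : topologicalType} {d : E -> E -> R}.
Hypotheses (md : is_metric d) (gd : generates_topology d).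

Lemma generates_nbhsP (x : E) (A : set E) :
  nbhs x A <-> exists2 e, 0 < e & forall y, d x y < e -> A y.
Proof. by rewrite gd; split=> -[e e0 eA]; exists e. Qed.

Lemma uniform_limit_is_continuous (X : topologicalType) (f : nat -> X -> E)
    (g : X -> E) :
  (forall n, continuous (f n)) ->
  (forall e, 0 < e -> exists n, forall x, d (g x) (f n x) < e) ->
  continuous g.
Proof.
have [_ dC dD] := md.
move=> cf fg x A /generates_nbhsP[e e0 eA].
have [n hn] : exists n, forall x, d (g x) (f n x) < e / 3.
  by apply: fg; rewrite divr_gt0.
have : \forall y \near x, d (f n x) (f n y) < e / 3.
  apply: (cf n x [set z | d (f n x) z < e / 3]); apply/generates_nbhsP.
  by exists (e / 3) => //; rewrite divr_gt0.
apply: filterS => y hy; apply: eA.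
have := dD (g x) (f n x) (g y); have := dD (f n x) (f n y) (g y).
have := hn x; have := hn y; rewrite (dC (g y)); lra.
Qed.

Lemma closed_metric_mem (A : set E) (l : E) : closed A ->
  (forall e, 0 < e -> exists2 z, A z & d l z < e) -> A l.
Proof.
move=> cA h; apply: cA => B /generates_nbhsP[e e0 eB].
by have [z Az lz] := h e e0; exists z; split=> //; exact: eB.
Qed.

End metrics.

Lemma dist_subr (R : realType) (E : zmodType) (d : E -> E -> R) u v :
  invariant_metric d -> d u v = d 0 (v - u).
Proof. by move=> inv; rewrite -(inv u v (- u)) subrr. Qed.

Lemma open_convex_nbhs0 (R : realType) (E : tvsType R) (A : set E) :
  nbhs 0 A -> exists W : set E, [/\ open W, convex_set W, W 0 & W `<=` A].
Proof.
move=> A0; have [B cB [oB Bbase]] := @locally_convex R E.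
have [W [BW W0] WA] := Bbase 0 A A0.
by exists W; split=> //; [exact: oB|apply: cB; rewrite inE].
Qed.

(** * Successive approximation *)

Definition close_to {X : Type} {E : zmodType} (Phi : set (X * E)) (V : set E)
    (f : X -> E) :=
  forall x, exists2 z, xsection Phi x z & V (f x - z).

(** Routing through a common [z] of [Phi(x)] is what makes a selection of this
    relation close to [Phi] and to [f] at the same time. *)
Definition approximation_rel {X : Type} {E : zmodType} (Phi : set (X * E))
    (f : X -> E) (V W : set E) : set (X * E) :=
  [set p | exists z, [/\ xsection Phi p.1 z, V (f p.1 - z) & W (p.2 - z)]].

Section successive_approximation.
Context {R : realType} {X : topologicalType} {E : tvsType R}.
Implicit Types (Phi : set (X * E)) (f : X -> E) (V W : set E).

Lemma nbhs_subr (a b : E) W : open W -> W (a - b) ->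
  exists P Q : set E, [/\ nbhs a P, open_nbhs b Q &
    forall a' b', P a' -> Q b' -> W (a' - b')].
Proof.
move=> oW Wab.
have : nbhs ((a, b).1 - (a, b).2) W by exact: open_nbhs_nbhs.
move=> /(@sub_continuous E (a, b))[[P Q]/= [aP]].
rewrite nbhsE => -[Q' bQ' Q'Q] PQ; exists P, Q'; split=> // a' b' Pa' Qb'.
by apply: (PQ (a', b')); split=> //; exact: Q'Q.
Qed.

(** If [(x, y)] is related through [z], then by lower semi-continuity [Phi(x')]
    still has points near [z] for [x'] near [x], and any of them relates [x']
    to all [y'] near [y]. *)
Lemma open_approximation_rel Phi f V W : lower_semicontinuous_rel Phi ->
  continuous f -> open V -> open W -> open (approximation_rel Phi f V W).
Proof.
move=> lscP cf oV oW; rewrite openE => -[x y] [z /= [Pz Vz Wz]].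
have [P1 [Q1 [fxP1 [oQ1 zQ1] PQ1]]] := nbhs_subr oV Vz.
have [P2 [Q2 [yP2 [oQ2 zQ2] PQ2]]] := nbhs_subr oW Wz.
exists (f @^-1` P1 `&` rel_preimage Phi (Q1 `&` Q2), P2).
  split=> //=; apply: filterI; first exact: cf.
  apply: open_nbhs_nbhs; split; first exact/lscP/openI.
  by exists z.
move=> [x' y'] /= [[fx'P1 [z' [Pz' [z'Q1 z'Q2]]]] y'P2].
by exists z'; split=> //=; [exact: PQ1|exact: PQ2].
Qed.

Lemma convex_approximation_rel Phi f V W : convex_valued Phi ->
  convex_set V -> convex_set W -> convex_valued (approximation_rel Phi f V W).
Proof.
move=> cP /convex_setP cV /convex_setP cW x; apply/convex_setP => y1 y2 t.
move=> /xsectionP[z1 /= [Pz1 Vz1 Wz1]] /xsectionP[z2 /= [Pz2 Vz2 Wz2]].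
apply/xsectionP; exists (conv t (z1 : convex_lmodType E) z2) => /=; split.
- exact: (convex_setP _).1 (cP x) _ _ _ Pz1 Pz2.
- rewrite -[f x](convmm t (f x : convex_lmodType E)) convB_lmod.
  exact: cV.
- by rewrite convB_lmod; exact: cW.
Qed.

Hypothesis open_selections : forall Theta : set (X * E),
  nonempty_valued Theta -> convex_valued Theta -> open Theta ->
  exists2 f : X -> E, continuous f & selection Theta f.

Lemma refine_approximation Phi f V W : convex_valued Phi ->
  lower_semicontinuous_rel Phi -> continuous f ->
  open V -> convex_set V -> open W -> convex_set W -> W 0 ->
  close_to Phi V f ->
  exists g, [/\ continuous g, close_to Phi W g &
    forall x, exists z, V (f x - z) /\ W (g x - z)].
Proof.
move=> cP lscP cf oV cV oW cW W0 fV.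
have [x|||g cg gP] := @open_selections (approximation_rel Phi f V W).
- have [z Pz Vz] := fV x; exists z; apply/xsectionP; exists z => /=.
  by rewrite subrr.
- exact: convex_approximation_rel.
- exact: open_approximation_rel.
exists g; split=> // x; have /xsectionP[z /= [Pz Vz Wz]] := gP x; exists z => //.
Qed.

Lemma approximating_sequence Phi (W : nat -> set E) : nonempty_valued Phi ->
  convex_valued Phi -> lower_semicontinuous_rel Phi ->
  (forall n, [/\ open (W n), convex_set (W n) & W n 0]) ->
  exists f : nat -> X -> E, forall n, [/\ continuous (f n),
    close_to Phi (W n) (f n) &
    forall x, exists z, W n (f n x - z) /\ W n.+1 (f n.+1 x - z)].
Proof.
move=> neP cP lscP WP.
have cT : convex_set [set: E] by apply/convex_setP.
have [oW0 cW0 W00] := WP 0%N.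
(* With the whole space as first neighbourhood, any map is close to Phi. *)
have [f0 [cf0 f0W _]] : exists g, [/\ continuous g, close_to Phi (W 0%N) g &
    forall x, exists z, [set: E] ((fun=> 0 : E) x - z) /\ W 0%N (g x - z)].
  apply: refine_approximation => //; first by move=> x; exact: cst_continuous.
    exact: openT.
  by move=> x; have [z] := neP x; exists z.
have [next nextP] : {next : nat * (X -> E) -> X -> E & forall nf,
    continuous nf.2 -> close_to Phi (W nf.1) nf.2 ->
    [/\ continuous (next nf), close_to Phi (W nf.1.+1) (next nf) &
      forall x, exists z, W nf.1 (nf.2 x - z) /\
        W nf.1.+1 (next nf x - z)]}.
  apply: (@choice _ _ (fun nf g => continuous nf.2 ->
    close_to Phi (W nf.1) nf.2 -> [/\ continuous g,
      close_to Phi (W nf.1.+1) g & forall x, exists z,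
        W nf.1 (nf.2 x - z) /\ W nf.1.+1 (g x - z)])) => -[n f] /=.
  have [[cf fW]|nf] := pselect (continuous f /\ close_to Phi (W n) f); last first.
    by exists f => cf fW; exfalso; exact: nf.
  have [oWn cWn _] := WP n; have [oWn1 cWn1 Wn10] := WP n.+1.
  by have [g gP] := refine_approximation cP lscP cf oWn cWn oWn1 cWn1 Wn10 fW;
    exists g.
pose f := fix F n := if n is m.+1 then next (m, F m) else f0.
have fP n : continuous (f n) /\ close_to Phi (W n) (f n).
  elim: n => [//|n [cf fW]].
  by have [] := nextP (n, f n) cf fW.
exists f => n; have [cf fW] := fP n.
by have [_ _ ?] := nextP (n, f n) cf fW.
Qed.

Lemma closed_convex_lsc_selection Phi : frechet E -> nonempty_valued Phi ->
  closed_valued Phi -> convex_valued Phi -> lower_semicontinuous_rel Phi ->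
  exists2 f : X -> E, continuous f & selection Phi f.
Proof.
move=> [d [md gd id cd]] neP clP cP lscP; have [_ dC dD] := md.
(* The exponent leaves room for 2^-(n+1) + 2^-(n+2) <= 2^-n below. *)
have [W WP] : {W : nat -> set E & forall n, [/\ open (W n), convex_set (W n),
    W n 0 & W n `<=` [set v | d 0 v < 2^-1 ^+ n.+1]]}.
  apply: (@choice _ _ (fun n W => [/\ open W, convex_set W,
    W 0 & W `<=` [set v : E | d 0 v < 2^-1 ^+ n.+1]])) => n.
  apply: open_convex_nbhs0; apply/(generates_nbhsP gd).
  by exists (2^-1 ^+ n.+1) => //; rewrite exprn_gt0.
have Wd n u v : W n (u - v) -> d v u < 2^-1 ^+ n.+1.
  by rewrite (dist_subr v u id); have [_ _ _] := WP n; apply.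
have [|f fP] := approximating_sequence neP cP lscP (W := W).
  by move=> n; have [] := WP n.
have f_cauchy n x : d (f n x) (f n.+1 x) <= 2^-1 ^+ n.
  have [_ _ /(_ x)[z [/Wd fz /Wd gz]]] := fP n.
  have h0 : 0 <= (2^-1 : R) ^+ n by rewrite exprn_ge0.
  have := dD (f n x) z (f n.+1 x); move: fz gz; rewrite !exprS (dC _ z); lra.
have [l lP] : {l : X -> E & forall x n, d (l x) (f n x) <= 2 * 2^-1 ^+ n}.
  apply: (@choice _ _ (fun x y => forall n, d y (f n x) <= 2 * 2^-1 ^+ n)) => x.
  exact: (halfX_cauchy_limit md cd) => n.
have half e : 0 < e -> exists n, (2^-1 : R) ^+ n < e / 4.
  by move=> e0; apply: exists_halfX_lt; rewrite divr_gt0.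
exists l.
  apply: (uniform_limit_is_continuous md gd) => [n|e e0].
    by have [] := fP n.
  by have [n hn] := half e e0; exists n => x; have := lP x n; lra.
move=> x; apply: (closed_metric_mem gd (clP x)) => e e0.
have [n hn] := half e e0; have [_ /(_ x)[z Pz /Wd fz] _] := fP n.
exists z => //; have h0 : 0 <= (2^-1 : R) ^+ n by rewrite exprn_ge0.
have := dD (l x) (f n x) z; have := lP x n; move: fz.
rewrite exprS (dC z); lra.
Qed.

End successive_approximation.

Theorem theorem3p3 (R : realType) (tau : Type) (X : topologicalType)
    (E : tvsType R) :
  frechet E ->
  infinite_set [set: tau] ->
  hausdorff_space X ->
  card_metacompact tau X ->
  density_le E tau ->
  (forall Theta : set (X * E),
     nonempty_valued Theta -> convex_valued Theta -> open Theta ->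
     exists2 f : X -> E, continuous f & selection Theta f)
  <->
  (forall Phi : set (X * E),
     nonempty_valued Phi -> closed_valued Phi -> convex_valued Phi ->
     lower_semicontinuous_rel Phi ->
     exists2 f : X -> E, continuous f & selection Phi f).
Proof.
move=> frE _ _ mcX dE; split=> [open_sel|closed_sel].
  by move=> Phi; exact: closed_convex_lsc_selection.
move=> Theta neT cvT oT.
have [Phi [neP clP cP lscP PT]] := lsc_selector_of_open_rel mcX dE neT cvT oT.
have [f cf fP] := closed_sel Phi neP clP cP lscP.
exists f => // x; apply/xsectionP/PT.
by have /xsectionP := fP x.
Qed.
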